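(* Let $\mathcal{A}=\{H_1,\dots,H_m\}$ be a central hyperplane arrangement in $\mathbb{R}^n$ with set of faces $\mathcal{F}$ and set of chambers $\mathcal{C}$, and let $w$ be a separating probability measure on $\mathcal{F}$. Assume that a group $G$ acts on $\mathbb{R}^n$ preserving the hyperplane arrangement $\mathcal{A}$ and acting transitively on the set $\mathcal{C}$ of chambers. If the weights $w$ are $G$-invariant, then $$s(t)=\mathbb{P}(T>t)$$ for every $t$, where $s(t)$ is the separation distance at time $t$ of the walk on $\mathcal{C}$ driven by $w$, and $T$ is the first time that the product of the faces picked is a chamber.
   Context: A central hyperplane arrangement $\mathcal{A}=\{H_1,\dots,H_m\}$ is a finite collection of hyperplanes of $\mathbb{R}^n$ passing through the origin. For each $i$, let $H_i^+,H_i^-$ be the two open half-spaces determined by $H_i$ and $H_i^0=H_i$. A face is a nonempty set of the form $F=\bigcap_{i=1}^m H_i^{\sigma_i(F)}$ with $\sigma_i(F)\in\{+,-,0\}$. A chamber is a face with $\sigma_i(F)\neq 0$ for all $i$. $\mathcal{F}$ is the set of faces and $\mathcal{C}\subseteq\mathcal{F}$ the set of chambers. The product $FF'$ of two faces is the face with $\sigma_i(FF')=\sigma_i(F)$ if $\sigma_i(F)\ne 0$ and $\sigma_i(FF')=\sigma_i(F')$ otherwise; it is associative, and $FC\in\mathcal{C}$ for $C\in\mathcal{C}$. A probability measure $w$ on $\mathcal{F}$ is separating if for every $H\in\mathcal{A}$ there is a face $F\nsubseteq H$ with $w(F)>0$. The weights are $G$-invariant if $w(gF)=w(F)$ for all $g\in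 G$, $F\in\mathcal{F}$. The walk: at each step a face is picked independently according to $w$; if $F^t$ is the face picked at time $t$, the walk started at $x_0\in\mathcal{C}$ is at time $t$ at $C^t_{x_0}=F^tF^{t-1}\cdots F^1x_0$. As $w$ is separating, this Markov chain has a unique stationary distribution $\pi$ on $\mathcal{C}$. $T$ is the first time $t$ such that $F^t\cdots F^1$ is a chamber. Separation distance: $s(t)=\max_{x_0\in\mathcal{C}}\left(1-\min_{x\in\mathcal{C}}\frac{\mathbb{P}(C^t_{x_0}=x)}{\pi(x)}\right)$. *)

(* Defs.v *)
From HB Require Import structures.
From mathcomp Require Import all_boot all_order all_algebra.
From mathcomp Require Import finmap all_classical all_reals all_analysis.

Set Implicit Arguments.
Unset Strict Implicit.
Unset Printing Implicit Defensive.

Import Order.TTheory GRing.Theory Num.Theory.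
Import numFieldNormedType.Exports.

Local Open Scope classical_set_scope.
Local Open Scope ring_scope.

Section Arrangement.
Variables (R : realType) (n m : nat).

Definition dotp (a x : 'rV[R]_n) : R := \sum_(k < n) a 0 k * x 0 k.

(* The signs +, -, 0 are encoded as Some true, Some false, None. *)
Definition side (a : 'rV[R]_n) (s : option bool) : set 'rV[R]_n :=
  match s with
  | Some true => [set x | 0 < dotp a x]
  | Some false => [set x | dotp a x < 0]
  | None => [set x | dotp a x = 0]
  end.

(* Each hyperplane is given by a nonzero normal vector, whose direction fixes
   which of the two half-spaces is the positive one. *)
Record arrangement := Arrangement {
  normal : 'I_m -> 'rV[R]_n;
  normal_neq0 : forall i, normal i != 0;
  hyperplane_inj : injective (fun i => side (normal i) None)
}.

Variable A : arrangement.

Definition hyperplane (i : 'I_m) : set 'rV[R]_n := side (normal A i) None.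

Definition cell (s : {ffun 'I_m -> option bool}) : set 'rV[R]_n :=
  [set x | forall i, side (normal A i) (s i) x].

(* Distinct sign vectors have disjoint cells, so that faces correspond
   bijectively to the sign vectors whose cell is nonempty. *)
Record face := Face {
  fsign :> {ffun 'I_m -> option bool};
  fsign_neq0 : `[< cell fsign !=set0 >]
}.

HB.instance Definition _ := [isSub for fsign].
HB.instance Definition _ := [Finite of face by <:].

Definition face_set (F : face) : set 'rV[R]_n := cell F.

Definition is_chamber (F : face) : bool := [forall i, F i != None].

Record chamber := Chamber {
  chamber_face :> face;
  chamberP : is_chamber chamber_face
}.

HB.instance Definition _ := [isSub for chamber_face].
HB.instance Definition _ := [Finite of chamber by <:].

Definition sign_mul (s s' : {ffun 'I_m -> option bool}) :
    {ffun 'I_m -> option bool} :=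
  [ffun i => if s i != None then s i else s' i].

Lemma dotpDZ a (e : R) x y : dotp a (x + e *: y) = dotp a x + e * dotp a y.
Proof.
rewrite /dotp mulr_sumr -big_split; apply: eq_bigr => k _.
by rewrite !mxE mulrDr mulrCA.
Qed.

Lemma dotp0 a : dotp a 0 = 0.
Proof. by rewrite /dotp big1 // => k _; rewrite mxE mulr0. Qed.

Lemma cell_mul_neq0 (F F' : face) : `[< cell (sign_mul F F') !=set0 >].
Proof.
case: F F' => s /asboolP[x xs] [s' /asboolP[y ys']] /=; apply/asboolP.
pose u i := dotp (normal A i) x; pose v i := dotp (normal A i) y.
pose S := 1 + \sum_i `|v i| / `|u i|.
have S1 : 1 <= S.
  by rewrite lerDl sumr_ge0 // => i _; rewrite divr_ge0.
have S0 : 0 < S by apply: lt_le_trans S1.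
have small i : u i != 0 -> `|S^-1 * v i| < `|u i|.
  move=> ui0; rewrite normrM normfV (gtr0_norm S0) mulrC ltr_pdivrMr //.
  rewrite mulrC -ltr_pdivrMr ?normr_gt0 // /S (bigD1 i) //= addrCA ltrDl.
  by rewrite ltr_pwDl // sumr_ge0 // => j _; rewrite divr_ge0.
exists (x + S^-1 *: y) => i; rewrite /sign_mul ffunE.
have := xs i; have := ys' i; have := small i; rewrite /u /v.
case: (s i) => [[]|] /=.
- move=> sm _ ui; rewrite dotpDZ.
  move: (sm (lt0r_neq0 ui)); rewrite (gtr0_norm ui) ltr_norml => /andP[h _].
  by rewrite -ltrBlDl sub0r.
- move=> sm _ ui; rewrite dotpDZ.
  move: (sm (ltr0_neq0 ui)); rewrite (ltr0_norm ui) ltr_norml => /andP[_ h].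
  by rewrite -ltrBrDl sub0r.
- move=> _; case: (s' i) => [[]|] /= hv hu; rewrite dotpDZ hu add0r.
  + by rewrite mulr_gt0 ?invr_gt0.
  + by rewrite pmulr_rlt0 ?invr_gt0.
  + by rewrite hv mulr0.
Qed.

Definition face_mul (F F' : face) : face := Face (cell_mul_neq0 F F').

Lemma cell_zero_neq0 : `[< cell [ffun=> None] !=set0 >].
Proof. by apply/asboolP; exists 0 => i; rewrite ffunE /= dotp0. Qed.

(* The intersection of all hyperplanes, which is the unit of face_mul. *)
Definition face_one : face := Face cell_zero_neq0.

Lemma face_mul_chamber (F : face) (C : chamber) : is_chamber (face_mul F C).
Proof.
apply/forallP => i; rewrite ffunE; case: ifP => // _.
by have /forallP := chamberP C.
Qed.

Definition face_act (F : face) (C : chamber) : chamber :=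
  Chamber (face_mul_chamber F C).

Definition is_distribution (I : finType) (p : I -> R) : Prop :=
  (forall i, 0 <= p i) /\ \sum_i p i = 1.

Definition separating (w : face -> R) : Prop :=
  forall i, exists F : face, ~ (face_set F `<=` hyperplane i) /\ 0 < w F.

Definition transition (w : face -> R) (x y : chamber) : R :=
  \sum_(F : face | face_act F x == y) w F.

Definition is_stationary (w : face -> R) (pi : chamber -> R) : Prop :=
  is_distribution pi /\
  forall y, \sum_(x : chamber) pi x * transition w x y = pi y.

Section GroupAction.
Variables (G : groupType) (act : G -> 'rV[R]_n -> 'rV[R]_n).

(* A (left) action of G on R^n by homeomorphisms. Linear actions are
   a special case; continuity is what makes gF a face. *)
Definition continuous_action : Prop :=
  [/\ forall x, act 1%g x = x,
      forall g h x, act (g * h)%g x = act g (act h x)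
    & forall g, continuous (act g)].

Definition preserves_arrangement : Prop :=
  forall g i, exists j, act g @` hyperplane i = hyperplane j.

Definition transitive_on_chambers : Prop :=
  forall C C' : chamber, exists g, act g @` face_set C = face_set C'.

Definition invariant_weights (w : face -> R) : Prop :=
  forall g (F F' : face), act g @` face_set F = face_set F' -> w F' = w F.

End GroupAction.

Section Walk.
Variables (d : measure_display) (Omega : measurableType d).
Variables (P : probability Omega R) (X : nat -> Omega -> face).

(* X k is the face picked at time k + 1; the last two clauses say that
   the X k have law w and are mutually independent. *)
Definition iid_faces (w : face -> R) : Prop :=
  [/\ forall k (F : face), measurable (X k @^-1` [set F]),
      forall k (F : face), P (X k @^-1` [set F]) = (w F)%:E
    & forall (J : {fset nat}) (B : nat -> set face),
        P (\bigcap_(j in [set` J]) X j @^-1` B j) =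
        (\prod_(j <- J) P (X j @^-1` B j))%E].

Fixpoint walk (x0 : chamber) (t : nat) (o : Omega) : chamber :=
  if t is t'.+1 then face_act (X t' o) (walk x0 t' o) else x0.

Fixpoint product (t : nat) (o : Omega) : face :=
  if t is t'.+1 then face_mul (X t' o) (product t' o) else face_one.

(* The first time at which the product is a chamber, +oo if there is none. *)
Definition first_time (o : Omega) : \bar R :=
  ereal_inf [set t%:R%:E | t in [set t : nat | is_chamber (product t o)]].

Definition separation (pi : chamber -> R) (t : nat) : \bar R :=
  (\big[maxe/-oo]_(x0 : chamber)
    (1 - \big[mine/+oo]_(x : chamber)
           (P [set o | walk x0 t o = x] / (pi x)%:E)))%E.

End Walk.

End Arrangement.

(* Main.v *)
Require Import Defs.
From HB Require Import structures.
From mathcomp Require Import all_boot all_order all_algebra.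
From mathcomp Require Import finmap all_classical all_reals all_analysis.
From mathcomp Require Import ring lra.

Set Implicit Arguments.
Unset Strict Implicit.
Unset Printing Implicit Defensive.

Import Order.TTheory GRing.Theory Num.Theory.
Import numFieldNormedType.Exports.

Local Open Scope classical_set_scope.
Local Open Scope ring_scope.

(** By associativity the walk at time t is the product F^t ... F^1 applied to
    x_0, and it equals this product as soon as the product is a chamber. An
    element of G permutes the hyperplanes and, being a homeomorphism, maps
    half-spaces to half-spaces, so it acts on the faces compatibly with the
    product. Hence the law of F^t ... F^1 is G-invariant and has the same mass
    P(T <= t) / N at each of the N chambers, and the stationary distribution is
    uniform. This gives P(C^t = x) / pi(x) >= P(T <= t) for all x; equality
    holds at x = - x_0, because F x_0 = - x_0 forces F = - x_0. *)

(** * Sign vectors of points and the monoid of faces *)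

Section Signs.
Variables (R : realType) (n m : nat) (A : arrangement R n m).
Implicit Types (x y z : 'rV[R]_n) (F E : face A) (i j : 'I_m).

Definition sgv (a x : 'rV[R]_n) : option bool :=
  if 0 < dotp a x then Some true else if dotp a x < 0 then Some false else None.

Lemma sideE a s x : side a s x <-> s = sgv a x.
Proof.
rewrite /sgv; case: s => [[]|] /=; case: ltgtP => // h; split=> // h';
  by move: h; rewrite h' ltxx.
Qed.

Definition signs x : {ffun 'I_m -> option bool} := [ffun i => sgv (normal A i) x].

Lemma cellE s x : cell A s x <-> s = signs x.
Proof.
split=> [h|-> i]; last by apply/sideE; rewrite ffunE.
by apply/ffunP => i; rewrite ffunE; apply/sideE/h.
Qed.

Lemma cell_signs_neq0 x : `[< cell A (signs x) !=set0 >].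
Proof. by apply/asboolP; exists x; apply/cellE. Qed.

(** The unique face containing [x]. Every face arises in this way, so identities between faces can
    be checked on representative points. *)
Definition face_of x : face A := Face (cell_signs_neq0 x).

Lemma face_setE F x : face_set F x <-> F = face_of x.
Proof.
by split=> [/cellE h|->]; [exact: val_inj | apply/cellE].
Qed.

Lemma face_ofE x i : face_of x i = sgv (normal A i) x.
Proof. by rewrite ffunE. Qed.

Lemma face_inhabited F : exists x, F = face_of x.
Proof. by have /asboolP[x /face_setE] := fsign_neq0 F; exists x. Qed.

Lemma face_mul_idem F : face_mul F F = F.
Proof. by apply/val_inj/ffunP => i; rewrite ffunE; case: ifP. Qed.

Lemma face_mulA : associative (@face_mul R n m A).
Proof.
move=> F1 F2 F3; apply/val_inj/ffunP => i; rewrite !ffunE.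
by case: (F1 i).
Qed.

Lemma face_mul1 F : face_mul (face_one A) F = F.
Proof. by apply/val_inj/ffunP => i; rewrite !ffunE. Qed.

Lemma face_mulr1 F : face_mul F (face_one A) = F.
Proof. by apply/val_inj/ffunP => i; rewrite !ffunE; case: (F i). Qed.

Lemma face_act_mul F E (C : chamber A) :
  face_act (face_mul F E) C = face_act F (face_act E C).
Proof. by apply/val_inj; rewrite /= face_mulA. Qed.

Lemma chamber_mull F E : is_chamber F -> face_mul F E = F.
Proof.
move=> /forallP FC; apply/val_inj/ffunP => i; rewrite !ffunE.
by have -> := FC i.
Qed.

Lemma is_chamber_mulr F E : is_chamber E -> is_chamber (face_mul F E).
Proof. by move=> EC; exact: (face_mul_chamber F (Chamber EC)). Qed.

Lemma dotpN (a x : 'rV[R]_n) : dotp a (- x) = - dotp a x.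
Proof.
by rewrite /dotp -sumrN; apply: eq_bigr => k _; rewrite mxE mulrN.
Qed.

Lemma sgvN (a x : 'rV[R]_n) : sgv a (- x) = omap negb (sgv a x).
Proof. by rewrite /sgv dotpN oppr_gt0 oppr_lt0; case: ltgtP. Qed.

(* If E C is opposite to C, then no coordinate of E vanishes. *)
Lemma opposite_chamber (C : chamber A) :
  exists D : chamber A, forall E : face A, face_act E C = D -> E = D.
Proof.
have [x Cx] := face_inhabited C.
have /forallP Cn0 := chamberP C.
have DC : is_chamber (face_of (- x)).
  apply/forallP => i; have := Cn0 i.
  by rewrite Cx !face_ofE sgvN; case: sgv.
exists (Chamber DC) => E /(congr1 (fun D : chamber A => chamber_face D)) /= EC.
rewrite -EC; apply/val_inj/ffunP => i; rewrite ffunE.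
have := congr1 (fun F : face A => F i) EC; have := Cn0 i.
rewrite ffunE Cx !face_ofE sgvN; case: (E i) => //=.
by case: sgv => [[]|].
Qed.

(** * Continuity, segments and sides of hyperplanes *)

Lemma dotp_continuous (a : 'rV[R]_n) : continuous (dotp a).
Proof.
have -> : dotp a = \sum_(k < n) (fun x : 'rV[R]_n => a 0 k * x 0 k).
  by apply/funext => x; rewrite fct_sumE.
apply: (big_ind (fun f : 'rV[R]_n -> R => continuous f))
  => [x|f g cf cg x|k _ x].
- exact: (@cst_continuous _ _ (0 : R)).
- by apply: continuousD; [exact: cf | exact: cg].
- apply: (@continuousM _ _ (cst (a 0 k)) (fun x : 'rV[R]_n => x 0 k)).
    exact: cst_continuous.
  exact: coord_continuous.
Qed.

Lemma segment_continuous x y :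
  continuous (fun s : R => x + s *: (y - x)).
Proof.
(* A neighbourhood of a matrix contains a box of entrywise neighbourhoods [Q], so continuity is
   checked entry by entry. *)
move=> s B [Q Qs QB].
have near_Q : \forall s' \near (s : R),
    forall k l, Q k l ((x + s' *: (y - x)) k l).
  apply: (@filter_forall _ _ _ (nbhs s)) => k.
  apply: (@filter_forall _ _ _ (nbhs s)) => l.
  have ckl : {for s, continuous (fun s' : R => (x + s' *: (y - x)) k l)}.
    have -> : (fun s' : R => (x + s' *: (y - x)) k l) =
              (fun s' => x k l + s' * (y - x) k l).
      by apply/funext => s'; rewrite !mxE.
    apply: continuousD; first exact: cst_continuous.
    by apply: continuousM; [move=> ? | exact: cst_continuous].
  by apply: ckl; exact: Qs.
by apply: filterS near_Q => s' Qs'; exact: QB.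
Qed.

(** Open half-spaces and hyperplanes are convex: along the segment the linear form is a convex
    combination of its values at the two ends. *)
Lemma sgv_segment (a x y : 'rV[R]_n) (s : R) : 0 <= s <= 1 ->
  sgv a x = sgv a y -> sgv a (x + s *: (y - x)) = sgv a x.
Proof.
move=> /andP[s0 s1].
have e : dotp a (x + s *: (y - x)) = (1 - s) * dotp a x + s * dotp a y.
  by rewrite dotpDZ -[- x]scaleN1r dotpDZ; ring.
rewrite /sgv {1 2}e; move: (dotp a x) (dotp a y) => u v.
case: (ltgtP u 0) => hu; case: (ltgtP v 0) => hv //= _.
- have h : (1 - s) * u + s * v < 0.
    (* One of the weights [1 - s] and [s] is at least 1/2, which makes the inequality strict. *)
    by have [s_half|s_half] := lerP s (1 / 2); nra.
  by rewrite h ltNge (ltW h).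
- have h : 0 < (1 - s) * u + s * v.
    by have [s_half|s_half] := lerP s (1 / 2); nra.
  by rewrite h.
- by rewrite hu hv !mulr0 addr0 ltxx.
Qed.

(* The image under f of a segment inside an open half-space avoids the
   hyperplane orthogonal to b, so by the intermediate value theorem it stays on
   one side of it. *)
Lemma sgv_transfer (f : 'rV[R]_n -> 'rV[R]_n) (a b x y : 'rV[R]_n) :
  continuous f -> (forall z, sgv b (f z) = None <-> sgv a z = None) ->
  sgv a x = sgv a y -> sgv b (f x) = sgv b (f y).
Proof.
move=> cf f0 xy.
have [ax0|ax0] := eqVneq (sgv a x) None.
  by rewrite (f0 x).2 // (f0 y).2 // -xy.
pose h s := dotp b (f (x + s *: (y - x))).
have h0 : h 0 = dotp b (f x) by rewrite /h scale0r addr0.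
have h1 : h 1 = dotp b (f y) by rewrite /h scale1r addrC subrK.
have ch : continuous h.
  move=> s; apply: (@continuous_comp _ _ _
    (f \o (fun s => x + s *: (y - x))) (dotp b)).
    by apply: continuous_comp; [exact: segment_continuous | exact: cf].
  exact: dotp_continuous.
have hN0 s : s \in `[0, 1] -> h s != 0.
  rewrite in_itv /= => s01; apply: contraNneq ax0 => hs.
  rewrite -(sgv_segment s01 xy); apply/eqP/f0.
  by rewrite /sgv -/(h s) hs ltxx.
have iv : ~ (Num.min (h 0) (h 1) <= 0 <= Num.max (h 0) (h 1)).
  move=> /(IVT ler01 (continuous_subspaceT ch))[c c01 hc].
  by have := hN0 c c01; rewrite hc eqxx.
have := hN0 0; have := hN0 1; rewrite !in_itv /= !lexx !ler01.
move=> /(_ isT) + /(_ isT); move: iv; rewrite /sgv -h0 -h1.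
case: (ltgtP (h 0) 0) => a0; case: (ltgtP (h 1) 0) => a1 //.
  by case; rewrite ge_min le_max !(ltW a0) (ltW a1) orbT.
by case; rewrite ge_min le_max (ltW a0) (ltW a1) orbT.
Qed.

End Signs.

(** * Symmetries of the weighted face monoid, and the action of [G] on faces *)

Section Symmetries.
Variables (R : realType) (n m : nat) (A : arrangement R n m) (w : face A -> R).

(** Weight-preserving automorphisms of the monoid of faces. This is all that the probabilistic part
    retains of the group [G]. *)
Definition symmetry (f : face A -> face A) : Prop :=
  [/\ bijective f, {morph f : F E / face_mul F E} & forall F, w (f F) = w F].

Lemma symmetry_one f : symmetry f -> f (face_one A) = face_one A.
Proof.
move=> [[g fK gK] fM _].
have := fM (face_one A) (g (face_one A)).
by rewrite face_mul1 gK face_mulr1.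
Qed.

(* Chambers are the left zeros of the monoid of faces. *)
Lemma symmetry_chamber f (C : chamber A) : symmetry f -> is_chamber (f C).
Proof.
move=> [[g fK gK] fM _].
have := fM C (g C); rewrite chamber_mull ?chamberP // gK => ->.
exact: face_mul_chamber.
Qed.

Section GroupAction.
Variables (G : groupType) (act : G -> 'rV[R]_n -> 'rV[R]_n).
Hypotheses (act_cont : continuous_action act)
  (act_arr : preserves_arrangement A act).

Lemma actK g : cancel (act g) (act g^-1%g).
Proof. by case: act_cont => a1 aM _ x; rewrite -aM mulVg a1. Qed.

Lemma actVK g : cancel (act g^-1%g) (act g).
Proof. by case: act_cont => a1 aM _ x; rewrite -aM mulgV a1. Qed.

(** The preimage of a hyperplane under [g] is its image under the inverse of [g], hence again a
    hyperplane of the arrangement. *)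
Lemma act_hyperplane g j : exists i, forall x,
  hyperplane A j (act g x) <-> hyperplane A i x.
Proof.
have [i gji] := act_arr g^-1%g j; exists i => x; rewrite -gji; split.
  by move=> h; exists (act g x) => //; rewrite actK.
by move=> [y Hy <-]; rewrite actVK.
Qed.

(** Let [g] pull hyperplane [j] back to hyperplane [i]. With respect to [i], the point [z] has the
    sign of [x], or that of [y] when [x] lies on the hyperplane; [sgv_transfer] carries this
    agreement of signs over to [j]. *)
Lemma act_face_mul g x y z :
  face_of A z = face_mul (face_of A x) (face_of A y) ->
  face_of A (act g z) = face_mul (face_of A (act g x)) (face_of A (act g y)).
Proof.
move=> zxy; apply/val_inj/ffunP => j; rewrite [RHS]ffunE !face_ofE.
have [i gi] := act_hyperplane g j.
have f0 u : sgv (normal A j) (act g u) = None <-> sgv (normal A i) u = None.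
  have := gi u; rewrite /hyperplane !sideE => -[h1 h2].
  by split=> h; apply/esym; [apply/h1 | apply/h2].
have cg : continuous (act g) by case: act_cont.
have := congr1 (fun F : face A => F i) zxy.
rewrite [in RHS]ffunE !face_ofE.
case: (eqVneq (sgv (normal A i) x) None) => xi /= zi.
  by rewrite (f0 x).2 //=; apply: sgv_transfer zi.
case: eqVneq => /= [/f0/eqP|_]; first by rewrite (negPf xi).
exact: sgv_transfer zi.
Qed.

(** Defined through an arbitrarily chosen point of [F]; [act_face_of] shows that the choice does not
    matter. *)
Definition act_face g (F : face A) : face A :=
  face_of A (act g (sval (cid (face_inhabited F)))).

Lemma act_face_of g x : act_face g (face_of A x) = face_of A (act g x).
Proof.
rewrite /act_face; case: cid => y /= xy.
(* Since faces are idempotent, two points of one face form an instance of the product rule, so their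
   images lie in one face. *)
by rewrite (@act_face_mul g x x y) ?face_mul_idem.
Qed.

Lemma act_face_set g F : act g @` face_set F = face_set (act_face g F).
Proof.
have [x ->] := face_inhabited F; rewrite act_face_of.
apply/seteqP; split=> y.
  by move=> [z /face_setE xz <-]; apply/face_setE; rewrite -!act_face_of xz.
move=> /face_setE gxy; exists (act g^-1%g y); last by rewrite actVK.
by apply/face_setE; rewrite -act_face_of -gxy act_face_of actK.
Qed.

Lemma act_faceP g (F F' : face A) :
  act g @` face_set F = face_set F' -> act_face g F = F'.
Proof.
rewrite act_face_set; have [x ->] := face_inhabited (act_face g F).
by move=> FF'; apply/esym/face_setE; rewrite -FF'; apply/face_setE.
Qed.

Lemma act_faceK g : cancel (act_face g) (act_face g^-1%g).
Proof.
by move=> F; have [x ->] := face_inhabited F; rewrite !act_face_of actK.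
Qed.

Lemma act_face_symmetry g : invariant_weights act w -> symmetry (act_face g).
Proof.
move=> w_inv; split.
- exists (act_face g^-1%g); first exact: act_faceK.
  by move=> F; rewrite -{1}[g]invgK act_faceK.
- move=> F E; have [x ->] := face_inhabited F; have [y ->] := face_inhabited E.
  have [z zxy] := face_inhabited (face_mul (face_of A x) (face_of A y)).
  by rewrite zxy !act_face_of; apply: act_face_mul.
- by move=> F; apply: (w_inv g); exact: act_face_set.
Qed.

End GroupAction.

End Symmetries.

(** * The law of a product of [t] independent faces, and the resulting transition matrix *)

Section ProductLaw.
Variables (R : realType) (n m : nat) (A : arrangement R n m) (w : face A -> R).
Hypothesis w_dist : is_distribution w.

(** The [t]-fold convolution power of [w] in the monoid of faces, with the newest face on the
    left. *)
Fixpoint product_law (t : nat) (E : face A) : R :=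
  if t is t'.+1 then
    \sum_(p : face A * face A | face_mul p.1 p.2 == E)
      w p.1 * product_law t' p.2
  else (E == face_one A)%:R.

Definition step_law (t : nat) (y x : chamber A) : R :=
  \sum_(E : face A | face_act E y == x) product_law t E.

Lemma product_law_ge0 t E : 0 <= product_law t E.
Proof.
elim: t E => [|t IH] E /=; first exact: ler0n.
by apply: sumr_ge0 => p _; rewrite mulr_ge0 // w_dist.1.
Qed.

Lemma product_law_sum t : \sum_E product_law t E = 1.
Proof.
elim: t => [|t IH] /=.
  by rewrite (bigD1 (face_one A)) //= eqxx big1 ?addr0 // => E /negPf->.
transitivity (\sum_(p : face A * face A) w p.1 * product_law t p.2).
  by rewrite [RHS](partition_big (fun p => face_mul p.1 p.2) xpredT).
rewrite -(pair_bigA _ (fun F E => w F * product_law t E)) /=.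
by under eq_bigr do rewrite -mulr_sumr IH mulr1; exact: w_dist.2.
Qed.

Lemma product_law_symmetry f t E : symmetry w f ->
  product_law t (f E) = product_law t E.
Proof.
move=> fS; have [[g fK gK] fM wf] := fS.
elim: t E => [|t IH] E /=.
  by rewrite -{1}(symmetry_one fS) (can_eq fK).
rewrite (reindex (fun p => (f p.1, f p.2))) /=; last first.
  by exists (fun p => (g p.1, g p.2)) => -[F E'] _ /=; rewrite ?fK ?gK.
by apply: eq_big => [p|p _]; rewrite -?fM ?(can_eq fK) // wf IH.
Qed.

(** Hyperplanes are treated one at a time: multiplying on the left by a face of positive weight not
    contained in hyperplane [i] makes sign [i] nonzero, and nonzero signs never become zero
    again. *)
Lemma product_law_full (s : seq 'I_m) : separating w ->
  exists t E, 0 < product_law t E /\ {in s, forall i, E i != None}.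
Proof.
move=> w_sep; elim: s => [|i s [t [E [E0 Es]]]].
  by exists 0%N, (face_one A); rewrite /= eqxx ltr01.
have [F [Fi wF]] := w_sep i.
exists t.+1, (face_mul F E); split.
  rewrite /= (bigD1 (F, E)) //= ltr_pwDl ?mulr_gt0 //.
  by apply: sumr_ge0 => p _; rewrite mulr_ge0 ?product_law_ge0 // w_dist.1.
move=> j; rewrite inE ffunE => /orP[/eqP->|/Es]; last by case: ifP.
case: ifPn => //; rewrite negbK => /eqP Fi0; exfalso; apply: Fi => x /(_ i).
by rewrite Fi0.
Qed.

Lemma product_law_chamber : separating w ->
  exists t (C : chamber A), 0 < product_law t C.
Proof.
move=> w_sep; have [t [E [E0 En]]] := product_law_full (enum 'I_m) w_sep.
have EC : is_chamber E by apply/forallP => i; apply: En; rewrite mem_enum.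
by exists t, (Chamber EC).
Qed.

(** A chamber absorbs whatever stands to its right, so a product equal to [x] sends every [y] to
    [x]. *)
Lemma step_law_ge t y (x : chamber A) : product_law t x <= step_law t y x.
Proof.
rewrite /step_law (bigD1 (chamber_face x)) /=.
  by rewrite lerDl sumr_ge0 // => E _; exact: product_law_ge0.
by apply/eqP/val_inj; rewrite /= chamber_mull // chamberP.
Qed.

Lemma step_law_sum t y : \sum_x step_law t y x = 1.
Proof.
rewrite -(product_law_sum t).
by rewrite [RHS](partition_big (fun E => face_act E y) xpredT).
Qed.

(** Both sides sum over pairs of a last face and an earlier product: the left one groups them by
    their product, the right one by the chamber reached before the last step. *)
Lemma step_lawS t y x :
  step_law t.+1 y x = \sum_z step_law t y z * transition w z x.
Proof.
transitivity (\sum_(p : face A * face A | face_act p.1 (face_act p.2 y) == x)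
  w p.1 * product_law t p.2).
  rewrite [RHS](partition_big (fun p => face_mul p.1 p.2)
    (fun E => face_act E y == x)) /= => [|p]; last by rewrite face_act_mul.
  apply: eq_bigr => E /eqP Ex; apply: eq_bigl => p.
  apply/idP/andP => [/eqP pE|[]//]; split; last exact/eqP.
  by rewrite -face_act_mul pE Ex.
rewrite (partition_big (fun p => face_act p.2 y) xpredT) //=.
apply: eq_bigr => z _; rewrite /step_law /transition mulr_suml.
under [RHS]eq_bigr do rewrite mulr_sumr.
rewrite pair_big /=.
rewrite (reindex (fun p : face A * face A => (p.2, p.1))) /=; last first.
  by exists (fun p => (p.2, p.1)) => -[].
apply: eq_big => [[F E]|[F E] _] /=; last by rewrite mulrC.
by rewrite andbC; case: eqP => //= ->.
Qed.

Lemma stationary_step pi t x : is_stationary w pi ->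
  \sum_y pi y * step_law t y x = pi x.
Proof.
move=> [_ pi_st]; elim: t x => [|t IH] x.
  have st0 y : step_law 0 y x = (y == x)%:R.
    rewrite /step_law /= big_mkcond (bigD1 (face_one A)) //= eqxx.
    rewrite big1 => [|E /negPf->].
      rewrite addr0; suff -> : face_act (face_one A) y = y by case: eqP.
      by apply/val_inj; rewrite /= face_mul1.
    by case: ifP.
  under eq_bigr do rewrite st0.
  by rewrite (bigD1 x) //= eqxx mulr1 big1 ?addr0 // => y /negPf->; rewrite mulr0.
under eq_bigr do rewrite step_lawS mulr_sumr.
rewrite exchange_big /= -[RHS]pi_st; apply: eq_bigr => z _.
by under eq_bigr do rewrite mulrA; rewrite -mulr_suml IH.
Qed.

(** * Consequences of transitivity: uniform stationary law and bounds for the walk *)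

Hypothesis transitive_symmetry : forall C D : chamber A,
  exists2 f, symmetry w f & f C = D.

Lemma product_law_chamber_const t (C D : chamber A) :
  product_law t C = product_law t D.
Proof.
by have [f fS <-] := transitive_symmetry C D; rewrite product_law_symmetry.
Qed.

Lemma product_law_chamber_sum t (C : chamber A) :
  \sum_(D : chamber A) product_law t D = #|{: chamber A}|%:R * product_law t C.
Proof.
under eq_bigr do rewrite (product_law_chamber_const t _ C).
by rewrite sumr_const mulr_natl.
Qed.

(** A symmetry taking [x] to [z] permutes the starting chambers and carries column [x] to column
    [z], so all column sums agree. Each row sums to 1, so the columns total the number of
    chambers. *)
Lemma step_law_colsum t x : \sum_y step_law t y x = 1.
Proof.
have const z : \sum_y step_law t y z = \sum_y step_law t y x.
  have [f fS fx] := transitive_symmetry x z.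
  have [[g fK gK] fM _] := fS.
  pose fC (C : chamber A) := Chamber (symmetry_chamber C fS).
  have fC_inj : injective fC.
    by move=> C D /(congr1 val)/(can_inj fK) CD; exact: val_inj.
  rewrite (reindex_inj fC_inj); apply: eq_bigr => y _; rewrite /step_law.
  rewrite (reindex_inj (can_inj fK)); apply: eq_big => [E|E _].
    have -> : z = fC x by apply/val_inj.
    have -> : face_act (f E) (fC y) = fC (face_act E y).
      by apply/val_inj; rewrite /= fM.
    exact: inj_eq.
  by rewrite product_law_symmetry.
have N0 : #|{: chamber A}|%:R != 0 :> R.
  by rewrite pnatr_eq0 -lt0n; apply/card_gt0P; exists x.
have : \sum_z \sum_y step_law t y z = #|{: chamber A}|%:R.
  rewrite exchange_big /=; under eq_bigr do rewrite step_law_sum.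
  by rewrite sumr_const.
under eq_bigr do rewrite const.
rewrite sumr_const -[LHS]mulr_natl => Nx.
by apply: (mulfI N0); rewrite mulr1; exact: Nx.
Qed.

(* At a maximum of pi, the mean of pi for a column of a positive doubly
   stochastic matrix equals that maximum, so pi is constant. *)
Lemma stationary_uniform pi x : separating w -> is_stationary w pi ->
  pi x = #|{: chamber A}|%:R^-1.
Proof.
move=> w_sep pi_st; have [t [C C0]] := product_law_chamber w_sep.
(* For this [t] one chamber has positive mass under the product law, hence all do, and every entry
   of the matrix is positive. *)
have step0 y z : 0 < step_law t y z.
  apply: lt_le_trans (step_law_ge t y z).
  by rewrite (product_law_chamber_const t z C).
case: (@Order.TotalTheory.arg_maxP _ _ _ C xpredT pi isT) => M _ Mmax.
have gap0 y : 0 <= (pi M - pi y) * step_law t y M.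
  by apply: mulr_ge0; [rewrite subr_ge0; exact: Mmax | exact: ltW].
have /psumr_eq0P gap : \sum_y (pi M - pi y) * step_law t y M = 0.
  under eq_bigr do rewrite mulrBl.
  by rewrite sumrB -mulr_sumr step_law_colsum mulr1 stationary_step // subrr.
have piM y : pi y = pi M.
  apply/eqP; rewrite eq_sym -subr_eq0.
  have /eqP := gap (fun z _ => gap0 z) y isT.
  by rewrite mulf_eq0 (gt_eqF (step0 _ _)) orbF.
have NpI : #|{: chamber A}|%:R * pi x = 1.
  rewrite -[RHS]pi_st.1.2 mulr_natl -sumr_const; apply: eq_bigr => y _.
  by rewrite piM [RHS]piM.
have N0 : #|{: chamber A}|%:R != 0 :> R.
  by apply: contra_eq_neq NpI => ->; rewrite mul0r eq_sym oner_eq0.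
by apply: (mulfI N0); rewrite NpI mulfV.
Qed.

Lemma separation_bound pi t x0 x : separating w -> is_stationary w pi ->
  \sum_(D : chamber A) product_law t D <= step_law t x0 x / pi x.
Proof.
move=> w_sep pi_st; rewrite (stationary_uniform _ w_sep pi_st) invrK.
by rewrite (product_law_chamber_sum t x) mulrC ler_wpM2r // step_law_ge.
Qed.

(** For [x] opposite to [x0], the only face sending [x0] to [x] is [x] itself, so the inequality of
    [step_law_ge] becomes an equality. *)
Lemma separation_attained pi t x0 : separating w -> is_stationary w pi ->
  exists x, step_law t x0 x / pi x = \sum_(D : chamber A) product_law t D.
Proof.
move=> w_sep pi_st; have [x xP] := opposite_chamber x0; exists x.
rewrite (stationary_uniform _ w_sep pi_st) invrK.
rewrite (product_law_chamber_sum t x) mulrC; congr (_ * _).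
rewrite /step_law (big_pred1 (chamber_face x)) // => E.
apply/eqP/eqP => [|->]; first exact: xP.
by apply/val_inj; rewrite /= chamber_mull // chamberP.
Qed.

End ProductLaw.

(** * Measurability and additivity for maps to a finite type *)

Section FinitePartition.
Variables (R : realType) (d : measure_display) (T : measurableType d).
Variables (I : finType) (Y : T -> I).
Hypothesis mY : forall i, measurable (Y @^-1` [set i]).

Lemma measurable_preimage_fin (B : set I) : measurable (Y @^-1` B).
Proof.
have -> : Y @^-1` B = \bigcup_(i in B) Y @^-1` [set i].
  apply/seteqP; split=> o; first by exists (Y o).
  by move=> [i Bi /= ->].
by apply: fin_bigcup_measurable => // i _; exact: mY.
Qed.

Lemma measure_partition (mu : {measure set T -> \bar R}) (S : set T) :
  measurable S -> mu S = (\sum_i mu (S `&` Y @^-1` [set i]))%E.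
Proof.
move=> mS; rewrite fsbig_seq ?index_enum_uniq //.
rewrite -measure_fin_bigcup //; last 2 first.
- by move=> i j _ _ [u [[_ /= <-] [_ /= <-]]].
- by move=> i _; exact: measurableI.
congr (mu _); apply/seteqP; split=> o; last by move=> [i _ []].
by exists (Y o) => //=; rewrite mem_index_enum.
Qed.

End FinitePartition.

(** * From independent picks to the laws of the product, the walk and the first time *)

Section WalkLaw.
Variables (R : realType) (n m : nat) (A : arrangement R n m) (w : face A -> R).
Variables (d : measure_display) (Omega : measurableType d).
Variables (P : probability Omega R) (X : nat -> Omega -> face A).
Hypothesis X_iid : iid_faces P X w.

Lemma walkE x0 t o : walk X x0 t o = face_act (product X t o) x0.
Proof.
elim: t => [|t IH] /=; last by rewrite IH face_act_mul.
by apply/val_inj; rewrite /= face_mul1.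
Qed.

Lemma product_chamber_mono s t o : (s <= t)%N ->
  is_chamber (product X s o) -> is_chamber (product X t o).
Proof.
move=> /subnK <-; elim: (t - s)%N => //= k IH h.
by apply: is_chamber_mulr; exact: IH.
Qed.

Lemma first_time_gt t o :
  (t%:R%:E < first_time X o)%E <-> ~~ is_chamber (product X t o).
Proof.
split=> [tT|tN].
  apply: contraTN tT => tC; rewrite -leNgt.
  by apply: ge_ereal_inf; exists t%:R%:E => //; exists t.
(* Strictness must survive the infimum, hence the lower bound [t.+1]; it also covers the empty set,
   with infimum +oo. *)
apply: (@lt_le_trans _ _ t.+1%:R%:E); first by rewrite lte_fin ltr_nat.
apply: le_ereal_inf_tmp => _ [s sC <-]; rewrite lee_fin ler_nat ltnNge.
by apply: contra tN => st; exact: product_chamber_mono sC.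
Qed.

Lemma measurable_X k F : measurable (X k @^-1` [set F]).
Proof. by case: X_iid. Qed.

Lemma measurable_product t E : measurable (product X t @^-1` [set E]).
Proof.
elim: t E => [|t IH] E /=.
  by rewrite preimage_cst; case: ifP.
have -> : (fun o => face_mul (X t o) (product X t o)) @^-1` [set E] =
    (fun o => (X t o, product X t o)) @^-1` [set p | face_mul p.1 p.2 = E] by [].
apply: measurable_preimage_fin => -[F E'].
have -> : (fun o => (X t o, product X t o)) @^-1` [set (F, E')] =
    X t @^-1` [set F] `&` product X t @^-1` [set E'].
  by apply/seteqP; split=> o /= [-> ->].
by apply: measurableI; [exact: measurable_X | exact: IH].
Qed.

(** The cylinder event that the picks from index [t] on begin with [l]. It provides the
    strengthening needed to derive the law of the product by induction. *)
Fixpoint picks (t : nat) (l : seq (face A)) : set Omega :=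
  if l is F :: l' then X t @^-1` [set F] `&` picks t.+1 l' else setT.

Lemma measurable_picks t l : measurable (picks t l).
Proof.
elim: l t => [|F l IH] t //=.
by apply: measurableI; [exact: measurable_X | exact: IH].
Qed.

Lemma picksP t l o : picks t l o <->
  forall i, (i < size l)%N -> X (t + i)%N o = nth (face_one A) l i.
Proof.
elim: l t => [|F l IH] t /=; first by split.
split=> [[Xt /IH h] [|i] il /=|h]; rewrite ?addn0 //.
  by rewrite addnS -addSn; exact: h.
split; first by have := h 0%N isT; rewrite addn0.
by apply/IH => i il; rewrite addSn -addnS; exact: (h i.+1).
Qed.

Lemma picks0_law l : P (picks 0 l) = (\prod_(F <- l) w F)%:E.
Proof.
case: X_iid => _ X_law X_indep.
pose J := [fset i in iota 0 (size l)]%fset.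
have -> : picks 0 l =
    \bigcap_(j in [set` J]) X j @^-1` [set nth (face_one A) l j].
  apply/seteqP; split=> o; [move=> /picksP h i|move=> h; apply/picksP => i il].
    by rewrite /= !inE mem_iota /= => il; exact: h.
  by apply: h; rewrite /= !inE mem_iota.
rewrite (X_indep J (fun j => [set nth (face_one A) l j])).
rewrite (eq_bigr (fun j => (w (nth (face_one A) l j))%:E)) => [|j _]; last first.
  exact: X_law.
rewrite prodEFin (big_nth (face_one A)) /index_iota subn0; congr EFin.
apply: perm_big; apply: uniq_perm; rewrite ?iota_uniq ?fset_uniq // => i.
by rewrite !inE.
Qed.

(* The second event only involves the faces picked after time t. *)
Lemma product_picks_law t E l :
  P (product X t @^-1` [set E] `&` picks t l) =
  (product_law w t E * \prod_(F <- l) w F)%:E.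
Proof.
elim: t E l => [|t IH] E l.
  have [->|E1] := eqVneq E (face_one A).
    have -> : product X 0 @^-1` [set face_one A] = setT by apply/seteqP; split.
    by rewrite setTI picks0_law /= eqxx mul1r.
  have -> : product X 0 @^-1` [set E] = set0.
    by apply/seteqP; split=> // o /= /esym/eqP; rewrite (negPf E1).
  by rewrite set0I measure0 /= (negPf E1) mul0r.
pose Y o := (X t o, product X t o).
have YE p : Y @^-1` [set p] =
    X t @^-1` [set p.1] `&` product X t @^-1` [set p.2].
  by case: p => F E'; rewrite /Y; apply/seteqP; split=> o /= [-> ->].
have mY p : measurable (Y @^-1` [set p]).
  rewrite YE; apply: measurableI; first exact: measurable_X.
  exact: measurable_product.
rewrite (measure_partition mY); last first.
  by apply: measurableI; [exact: measurable_product | exact: measurable_picks].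
rewrite /= mulr_suml [in RHS]big_mkcond -sumEFin; apply: eq_bigr => -[F E'] _ /=.
case: eqP => FE.
  (* The pick of index [t] leaves the product and becomes the head of the list of prescribed
     picks. *)
  have := IH E' (F :: l); rewrite big_cons mulrCA mulrA => <-.
  congr (P _); rewrite YE.
  by apply/seteqP; split=> o /=; [move=> [[_ ?] [? ?]] | move=> [-> [-> ?]]].
rewrite (_ : _ `&` _ = set0) ?measure0 // YE.
apply/seteqP; split=> // o /= [[FE' _] [XF pE]].
by apply: FE; rewrite -FE' XF pE.
Qed.

Lemma product_prob t E : P (product X t @^-1` [set E]) = (product_law w t E)%:E.
Proof. by have := product_picks_law t E [::]; rewrite setIT big_nil mulr1. Qed.

Lemma product_prob_pred t (B : pred (face A)) :
  P (product X t @^-1` [set` B]) = (\sum_(E | B E) product_law w t E)%:E.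
Proof.
rewrite (measure_partition (@measurable_product t)); last first.
  exact: measurable_preimage_fin (@measurable_product t) _.
rewrite [in RHS]big_mkcond -sumEFin; apply: eq_bigr => E _; case: ifPn => BE.
  rewrite -product_prob; congr (P _); apply/seteqP; split=> o /= [] // ->.
  by split.
rewrite (_ : _ `&` _ = set0) ?measure0 //.
by apply/seteqP; split=> // o /= [+ pE]; rewrite pE; apply/negP.
Qed.

Lemma walk_prob x0 t x : P [set o | walk X x0 t o = x] = (step_law w t x0 x)%:E.
Proof.
rewrite -product_prob_pred; congr (P _).
by apply/seteqP; split=> o /=; rewrite walkE => /eqP.
Qed.

Lemma sum_chamber (f : face A -> R) :
  \sum_(E | is_chamber E) f E = \sum_(C : chamber A) f C.
Proof.
rewrite (reindex_omap (@chamber_face R n m A) insub) => [|E EC]; last first.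
  by rewrite insubT.
by apply: eq_bigl => C; rewrite chamberP /= valK eqxx.
Qed.

Lemma first_time_prob t : P [set o | (t%:R%:E < first_time X o)%E] =
  (1 - (\sum_(C : chamber A) product_law w t C)%:E)%E.
Proof.
rewrite -sum_chamber -product_prob_pred -probability_setC; last first.
  exact: measurable_preimage_fin (@measurable_product t) _.
congr (P _); apply/seteqP.
by split=> o /=; [move=> /first_time_gt/negP | move=> /negP/first_time_gt].
Qed.

End WalkLaw.

Theorem theorem1 (R : realType) (n m : nat) (A : arrangement R n m)
    (w : face A -> R) (w_dist : is_distribution w) (w_sep : separating w)
    (G : groupType) (act : G -> 'rV[R]_n -> 'rV[R]_n)
    (act_cont : continuous_action act)
    (act_arr : preserves_arrangement A act)
    (act_trans : transitive_on_chambers A act)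
    (w_inv : invariant_weights act w)
    (pi : chamber A -> R) (pi_stat : is_stationary w pi)
    (d : measure_display) (Omega : measurableType d) (P : probability Omega R)
    (X : nat -> Omega -> face A) (X_iid : iid_faces P X w) (t : nat) :
  separation P X pi t = P [set o | (t%:R%:E < first_time X o)%E].
Proof.
have sym_trans (C D : chamber A) : exists2 f, symmetry w f & f C = D.
  have [g gCD] := act_trans C D; exists (act_face act g).
    exact: act_face_symmetry.
  exact: act_faceP.
(* The existence of a chamber ensures that the maximum over starting chambers is not its default
   value -oo. *)
have [_ [C0 _]] := product_law_chamber w_dist w_sep.
have pi_neq0 x : pi x != 0.
  rewrite (stationary_uniform w_dist sym_trans _ w_sep pi_stat) invr_eq0.
  by rewrite pnatr_eq0 -lt0n; apply/card_gt0P; exists x.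
rewrite (first_time_prob X_iid) /separation.
set c := \sum_C _.
have min_c x0 :
    (\big[mine/+oo]_x (P [set o | walk X x0 t o = x] / (pi x)%:E) = c%:E)%E.
  (* As [pi] does not vanish, the extended quotient is a real one. *)
  under eq_bigr do rewrite (walk_prob X_iid) inver (negPf (pi_neq0 _)) -EFinM.
  apply/eqP; rewrite eq_le; apply/andP; split.
    have [x xc] := separation_attained w_dist sym_trans t x0 w_sep pi_stat.
    by rewrite /c -xc; exact: bigmin_le.
  apply: le_bigmin => [|x _]; first exact: leey.
  by rewrite lee_fin; exact: separation_bound.
(* The minimum is the same for every starting chamber, so the maximum runs over a constant. *)
under eq_bigr do rewrite min_c.
apply/eqP; rewrite eq_le; apply/andP; split; last first.
  exact: (@le_bigmax _ _ _ -oo%E (fun=> 1 - c%:E)%E C0).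
by apply: bigmax_le => //; exact: leNye.
Qed.
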